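(* There exists a Heffter array $H(n;k)$ for all $n\equiv 2\pmod 4$ and $k\equiv 3\pmod 4$ with $n>k\ge 3$.
   Context: A Heffter array $H(n;k)$ is an $n\times n$ array in which some cells are filled with nonzero integers and the others are empty, such that: each row and each column contains exactly $k$ filled cells; the entries of every row and of every column sum to $0$ modulo $2nk+1$; and for each integer $1\le x\le nk$, exactly one of $x$ or $-x$ appears in the array, and it appears exactly once. *)

(* Defs.v *)
From mathcomp Require Import all_boot all_order all_algebra.
Set Implicit Arguments. Unset Strict Implicit. Unset Printing Implicit Defensive.
Import Order.TTheory GRing.Theory Num.Theory.
Local Open Scope ring_scope.

(* A partially filled n x n array of integers: None = empty cell. *)
Definition parray (n : nat) := 'I_n -> 'I_n -> option int.

Definition cell_val (o : option int) : int := if o is Some y then y else 0.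

Definition is_heffter (n k : nat) (A : parray n) : Prop :=
  (forall i j y, A i j = Some y -> y != 0) /\
  (forall i : 'I_n, #|[set j : 'I_n | A i j != None]| = k) /\
  (forall j : 'I_n, #|[set i : 'I_n | A i j != None]| = k) /\
  (forall i : 'I_n,
      ((\sum_(j < n) cell_val (A i j)) %% (2 * n * k + 1)%:Z)%Z = 0) /\
  (forall j : 'I_n,
      ((\sum_(i < n) cell_val (A i j)) %% (2 * n * k + 1)%:Z)%Z = 0) /\
  (forall x : nat, (1 <= x <= n * k)%N ->
      #|[set ij : 'I_n * 'I_n |
          (A ij.1 ij.2 == Some x%:Z) || (A ij.1 ij.2 == Some (- x%:Z))]| = 1%N).
Arguments is_heffter : clear implicits.

(* Main.v *)
(* Let N = n k. Three cells of each line carry a band array, whose entries are encoded by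
   their doubles modulo 2 N + 1: an even integer z encodes z / 2, and an odd z encodes an
   entry of absolute value N - (|z| - 1) / 2, because 2 (N - i) is congruent to - (2 i + 1). Three
   encoded values with sum 0 thus give entries with sum 0 modulo 2 N + 1, and the encoded
   array does not depend on k. It is obtained from a cyclic sequence d and a constant c:
   row i has d_i, - (d_i + d_(i+1) + c) and d_(i+1) + c in columns i, i + 1, i + 2, so
   that all lines have sum 0; its absolute values have to be 2, 4, .., 2 a and
   1, 3, .., 2 b - 1, with a + b = 3 n. The entries still to be placed are then the
   integers of the interval ]a, N - b], whose length is a multiple of 4 n; they fill 2x2
   blocks [x, -(x+1); -(x+2), x+3] with alternating signs, whose line sums cancel in pairs
   of neighbouring block diagonals. *)

Require Import Defs.
From mathcomp Require Import all_boot all_order all_algebra.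
From mathcomp Require Import zify.
Set Implicit Arguments. Unset Strict Implicit. Unset Printing Implicit Defensive.
Import Order.TTheory GRing.Theory Num.Theory.
Local Open Scope ring_scope.

(** * Cyclic sequences that generate the band *)

Definition succ_mod (n i : nat) : nat := if (i.+1 < n)%N then i.+1 else 0%N.

Definition zigzag (n : nat) (d : nat -> int) (c : int) (i t : nat) : int :=
  match t with
  | 0 => d i
  | 1 => - (d i + d (succ_mod n i) + c)
  | _ => d (succ_mod n i) + c
  end.

(** Surjectivity is enough: when [a + b = 3 * n], there are as many cells as prescribed values. *)
Definition zigzag_onto (n a b : nat) (d : nat -> int) (c : int) : Prop :=
  forall z : nat, (if odd z then z < b.*2 else 0 < z <= a.*2)%N ->
  exists i t, [/\ (i < n)%N, (t < 3)%N & `|zigzag n d c i t|%N = z].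

(* [d_large 0] is not a solution for n = 6. *)
Definition d_6 (i : nat) : int :=
  nth 0 [:: - 26%:Z; 10%:Z; - 1%:Z; - 2%:Z; - 20%:Z; 16%:Z] i.

Lemma zigzag_onto_6 : zigzag_onto 6 14 4 d_6 (- 2%:Z).
Proof.
pose s := [seq (i, t) | i <- iota 0 6, t <- iota 0 3].
pose v (it : nat * nat) := `|zigzag 6 d_6 (- 2%:Z) it.1 it.2|%N.
have vs : all (fun z => (if odd z then z < 8 else 0 < z <= 28)%N ==> (z \in map v s))
              (iota 0 29) by vm_compute.
move=> z hz; have z29 : z \in iota 0 29 by rewrite mem_iota; case: (odd z) hz; lia.
have /mapP[_ /allpairsP[[i t] [i6 t3 ->]] ->] := implyP (allP vs z z29) hz.
by rewrite !mem_iota in i6 t3; exists i, t.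
Qed.

(* Found by computer search among the sequences made of two zigzags of arithmetic
   progressions of lengths linear in h. *)
Definition d_large (h i : nat) : int :=
  if (i <= 2 * h)%N then
    if odd i then (10 * h + 9 + i)%:Z else i%:Z - (6 * h + 5)%:Z
  else if i == (2 * h + 1)%N then (4 * h + 6)%:Z
  else if i == (2 * h + 2)%N then - (8 * h + 9)%:Z
  else if i == (2 * h + 3)%N then (4 * h + 8)%:Z
  else if (i < 4 * h + 4)%N then
    if odd i then - (4 * h + 4 + i)%:Z else (12 * h + 12)%:Z - i%:Z
  else if i == (4 * h + 4)%N then - 4%:Z else - 2%:Z.

Ltac solve_at H i t :=
  apply: (H i t); [lia | by [] |
  rewrite /zigzag /succ_mod; try (case: ifP => ?; try lia); rewrite /d_large /=;
  try lia; repeat (case: ifP => ?; try lia)].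

(** On each of the two zigzags, the terms of even and of odd index form progressions of opposite
    parity with steps 1 and -1 in [i], and [d_i + d_(i+1) + c] equals [2 i - 4 h - 4] on the first
    and [- 2 i - 2] on the second. Each long range of [z] below lies in one such progression, solved
    for [i]; the short ranges contain one value each, coming from the junctions and ends of the
    zigzags. *)
Lemma zigzag_onto_large (h : nat) : (0 < h)%N ->
  zigzag_onto (4 * h + 6) (8 * h + 10) (4 * h + 8) (d_large h) (- (8 * h + 9)%:Z).
Proof.
move=> h_gt0 z hz.
have at_cell i t : (i < 4 * h + 6)%N -> (t < 3)%N ->
    `|zigzag (4 * h + 6) (d_large h) (- (8 * h + 9)%:Z) i t|%N = z ->
    exists i t, [/\ (i < 4 * h + 6)%N, (t < 3)%N &
      `|zigzag (4 * h + 6) (d_large h) (- (8 * h + 9)%:Z) i t|%N = z].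
  by exists i, t.
case: ifP hz => z_odd hz.
  case: (ltnP z (2 * h)) => ?; first by solve_at at_cell (4 * h + 2 - z)%N 2%N.
  case: (ltnP z (4 * h)) => ?; first by solve_at at_cell (z - 2 * h - 1)%N 2%N.
  case: (leqP z (4 * h + 1)) => ?; first by solve_at at_cell (2 * h + 2)%N 2%N.
  case: (leqP z (4 * h + 3)) => ?; first by solve_at at_cell (2 * h)%N 2%N.
  case: (leqP z (6 * h + 5)) => ?; first by solve_at at_cell (6 * h + 5 - z)%N 0%N.
  case: (leqP z (6 * h + 7)) => ?; first by solve_at at_cell (2 * h + 3)%N 1%N.
  case: (leqP z (8 * h + 7)) => ?; first by solve_at at_cell (z - 4 * h - 4)%N 0%N.
  case: (leqP z (8 * h + 9)) => ?; first by solve_at at_cell (2 * h + 2)%N 0%N.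
  case: (leqP z (8 * h + 11)) => ?; first by solve_at at_cell (4 * h + 4)%N 2%N.
  case: (leqP z (8 * h + 13)) => ?; first by solve_at at_cell (4 * h + 3)%N 2%N.
  solve_at at_cell (4 * h + 4)%N 1%N.
(* The even values, up to [2 a = 16 h + 20]. *)
case: (leqP z 2) => ?; first by solve_at at_cell (4 * h + 5)%N 0%N.
case: (leqP z 4) => ?; first by solve_at at_cell (4 * h + 4)%N 0%N.
case: (leqP z (4 * h + 4)) => ?; first by solve_at at_cell ((4 * h + 4 - z) %/ 2)%N 1%N.
case: (leqP z (4 * h + 6)) => ?; first by solve_at at_cell (2 * h + 1)%N 0%N.
case: (leqP z (4 * h + 8)) => ?; first by solve_at at_cell (2 * h + 3)%N 0%N.
case: (leqP z (8 * h + 6)) => ?; first by solve_at at_cell (z %/ 2 - 1)%N 1%N.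
case: (leqP z (8 * h + 8)) => ?; first by solve_at at_cell (2 * h)%N 1%N.
case: (leqP z (10 * h + 8)) => ?; first by solve_at at_cell (12 * h + 12 - z)%N 0%N.
case: (leqP z (12 * h + 8)) => ?; first by solve_at at_cell (z - 10 * h - 9)%N 0%N.
case: (leqP z (12 * h + 10)) => ?; first by solve_at at_cell (2 * h + 2)%N 1%N.
case: (leqP z (12 * h + 12)) => ?; first by solve_at at_cell (2 * h + 1)%N 1%N.
case: (leqP z (14 * h + 12)) => ?; first by solve_at at_cell (14 * h + 13 - z)%N 2%N.
case: (leqP z (14 * h + 14)) => ?; first by solve_at at_cell (4 * h + 5)%N 2%N.
case: (leqP z (14 * h + 16)) => ?; first by solve_at at_cell (4 * h + 5)%N 1%N.
case: (leqP z (16 * h + 16)) => ?; first by solve_at at_cell (z - 12 * h - 14)%N 2%N.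
case: (leqP z (16 * h + 18)) => ?; first by solve_at at_cell (2 * h + 1)%N 2%N.
solve_at at_cell (4 * h + 3)%N 1%N.
Qed.

(** * Reduction of exactness to surjectivity *)

(* There are n k filled cells, so hitting each x once means hitting it exactly once. *)
Lemma is_heffter_of_onto (n k : nat) (A : parray n) :
  (forall i : 'I_n, \sum_(j < n) (A i j != None) = k)%N ->
  (forall j : 'I_n, \sum_(i < n) (A i j != None) = k)%N ->
  (forall i : 'I_n,
     ((\sum_(j < n) cell_val (A i j)) %% (2 * n * k + 1)%:Z)%Z = 0) ->
  (forall j : 'I_n,
     ((\sum_(i < n) cell_val (A i j)) %% (2 * n * k + 1)%:Z)%Z = 0) ->
  (forall x : nat, (1 <= x <= n * k)%N ->
     exists i j y, A i j = Some y /\ `|y|%N = x) ->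
  is_heffter n k A.
Proof.
move=> rowk colk row0 col0 onto.
have cardE (P : pred 'I_n) : #|[set j | P j]| = (\sum_(j < n) P j)%N.
  by rewrite -sum1dep_card big_mkcond.
pose F := [set ij : 'I_n * 'I_n | A ij.1 ij.2 != None].
have cardF : #|F| = (n * k)%N.
  rewrite -sum1dep_card big_mkcond /=.
  rewrite -(pair_bigA _ (fun i j => if A i j != None then 1 else 0)%N) /=.
  by rewrite (eq_bigr (fun=> k)) ?sum_nat_const ?card_ord // => i _; rewrite -(rowk i).
(* Ordinals start at 0, so [g x] is a cell of absolute value [x + 1]. The map [g] is injective into
   the [n k] filled cells, hence enumerates them all. *)
have /fin_all_exists[g gP] (x : 'I_(n * k)) :
    exists ij, exists2 y, A ij.1 ij.2 = Some y & `|y|%N = x.+1.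
  have [|i [j [y [Aij yx]]]] := onto x.+1; first by have := ltn_ord x; lia.
  by exists (i, j), y.
have g_inj : injective g.
  move=> x x' gxx'; have [y Ay yx] := gP x; have [y' Ay' yx'] := gP x'.
  by apply: val_inj; move: Ay Ay' yx yx' => /=; rewrite gxx' => -> [->] -> [].
have imF : g @: setT = F.
  apply/eqP; rewrite eqEcard card_imset // cardsT card_ord cardF leqnn andbT.
  by apply/subsetP => _ /imsetP[x _ ->]; rewrite inE; have [y ->] := gP x.
have FP ij : A ij.1 ij.2 != None -> exists x, ij = g x.
  move=> ijF; have /imsetP[x _ ijx] : ij \in g @: setT by rewrite imF inE.
  by exists x.
split; [|split; [|split; [|split; [|split]]]] => //.
- move=> i j y Aij; have [|x ijx] := FP (i, j); first by rewrite /= Aij.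
  by have [y' Ay' yx] := gP x; move: Ay' yx; rewrite -ijx /= Aij => -[->]; lia.
- by move=> i; rewrite cardE.
- by move=> j; rewrite cardE.
move=> x x_bd; have x1_lt : (x.-1 < n * k)%N by lia.
suff -> : [set ij : 'I_n * 'I_n | (A ij.1 ij.2 == Some x%:Z) ||
  (A ij.1 ij.2 == Some (- x%:Z))] = [set g (Ordinal x1_lt)] by rewrite cards1.
have inS ij : (A ij.1 ij.2 == Some x%:Z) || (A ij.1 ij.2 == Some (- x%:Z)) =
    if A ij.1 ij.2 is Some y then `|y|%N == x else false.
  by case: (A _ _) => // y; rewrite !(inj_eq (@Some_inj _)); lia.
apply/setP => ij; rewrite !inE inS; apply/idP/eqP => [|->]; last first.
  by have [y -> /= ->] := gP (Ordinal x1_lt); apply/eqP; lia.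
case Aij: (A _ _) => [y|] // /eqP yx.
have [|x' ijx'] := FP ij; first by rewrite Aij.
rewrite ijx'; congr g; apply: val_inj => /=.
by have [y' Ay' yx'] := gP x'; move: Ay' yx'; rewrite -ijx' Aij => -[<-]; lia.
Qed.

(** * Halving modulo 2 N + 1 *)

(* The representative of z / 2 modulo 2 N + 1 of absolute value at most N, for `|z| <= 2 N. *)
Definition half_mod (N : nat) (z : int) : int :=
  if ~~ odd `|z|%N then (z %/ 2)%Z
  else if 0 < z then (z %/ 2)%Z - N%:Z else (z %/ 2)%Z + N.+1%:Z.

(** An odd [z] is halved as [(z - (2 N + 1)) / 2] if positive and as [(z + (2 N + 1)) / 2] if
    negative. Zero or two of the summands are odd, so the corrections add up to -1, 0 or 1 times
    [2 N + 1]. *)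
Lemma half_mod_sum3 (N : nat) (x y z : int) : x + y + z = 0 ->
  ((half_mod N x + half_mod N y + half_mod N z) %% (2 * N + 1)%:Z)%Z = 0.
Proof.
move=> xyz0; suff [q ->] : exists q, half_mod N x + half_mod N y + half_mod N z =
    q * (2 * N + 1)%:Z by rewrite modzMl.
rewrite /half_mod; do 3 (case: ifP => ?; last case: ifP => ?);
  first [lia | exists 0; lia | exists 1; lia | exists (-1); lia].
Qed.

Lemma half_mod_even (N x : nat) (z : int) : `|z|%N = x.*2 -> `|half_mod N z|%N = x.
Proof. by move=> zx; rewrite /half_mod; case: ifP => ?; last case: ifP => ?; lia. Qed.

Lemma half_mod_odd (N x : nat) (z : int) : (x <= N)%N ->
  `|z|%N = ((N - x).*2 + 1)%N -> `|half_mod N z|%N = x.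
Proof.
by move=> xN zx; rewrite /half_mod; case: ifP => ?; last case: ifP => ?; lia.
Qed.

(** * Reindexing of iterated operations *)

Lemma big_permute (R : Type) (idx : R) (op : Monoid.com_law idx) (n : nat)
    (s : nat -> nat) (F : nat -> R) :
  (forall x, (x < n)%N -> (s x < n)%N) ->
  (forall x y, (x < n)%N -> (y < n)%N -> s x = s y -> x = y) ->
  \big[op/idx]_(0 <= x < n) F (s x) = \big[op/idx]_(0 <= x < n) F x.
Proof.
move=> s_lt s_inj; rewrite /index_iota subn0 -(big_map s xpredT F).
apply: perm_big; have s_uniq : uniq (map s (iota 0 n)).
  rewrite map_inj_in_uniq ?iota_uniq // => x y; rewrite !mem_iota /= !add0n.
  exact: s_inj.
rewrite uniq_perm ?iota_uniq //; apply: (uniq_min_size s_uniq _ _).2.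
  by move=> _ /mapP[x + ->]; rewrite !mem_iota /= !add0n; exact: s_lt.
by rewrite size_map.
Qed.

Lemma big_double (R : Type) (idx : R) (op : Monoid.law idx) (n : nat) (F : nat -> R) :
  \big[op/idx]_(0 <= i < n.*2) F i =
  \big[op/idx]_(0 <= i < n) op (F i.*2) (F i.*2.+1).
Proof.
elim: n => [|n IHn]; first by rewrite !big_nil.
by rewrite doubleS !big_nat_recr //= IHn Monoid.mulmA.
Qed.

(** Made for sums over block diagonals: the first two carry the band, the next [2 p] are grouped in
    neighbouring pairs, the others are empty. *)
Lemma big_two_pairs (R : Type) (idx : R) (op : Monoid.law idx) (m p : nat) (F : nat -> R) :
  (p.*2.+2 <= m)%N -> (forall i, (p.*2.+2 <= i)%N -> F i = idx) ->
  \big[op/idx]_(0 <= i < m) F i =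
  op (op (F 0%N) (F 1%N)) (\big[op/idx]_(0 <= r < p) op (F r.*2.+2) (F r.*2.+3)).
Proof.
move=> pm F_idx; rewrite (@big_cat_nat _ _ _ p.*2.+2) //=.
rewrite [X in op _ X]big_nat_cond [X in op _ X]big1 => [|i /andP[/andP[/F_idx]] //].
rewrite Monoid.mulm1 big_ltn // big_ltn // Monoid.mulmA; congr (op _ _).
by rewrite !big_add1 big_double.
Qed.

(** * Block diagonals and the array *)

Definition block_shift (m I J : nat) : nat :=
  if (I <= J)%N then (J - I)%N else (J + m - I)%N.

Lemma block_shift_lt (m I J : nat) : (I < m)%N -> (J < m)%N -> (block_shift m I J < m)%N.
Proof. by rewrite /block_shift; case: ifP => ?; lia. Qed.

Lemma block_shift_inj (m I J J' : nat) : (I < m)%N -> (J < m)%N -> (J' < m)%N ->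
  block_shift m I J = block_shift m I J' -> J = J'.
Proof. by rewrite /block_shift; do 2 case: ifP; lia. Qed.

(** Modulo [m], [s = J - I] gives [I = J - s]: in block column [J], the same function turns a block
    diagonal back into a block row. *)
Lemma block_shiftK (m I J : nat) : (I < m)%N -> (J < m)%N ->
  block_shift m (block_shift m I J) J = I.
Proof.
by rewrite {2}/block_shift; case: ifP => ? ? ?; rewrite /block_shift; case: ifP => ?; lia.
Qed.

(* The cell in block row I, row e of the block, block column I + s mod m, column f of the
   block. *)
Definition cell (m p a : nat) (d : nat -> int) (c : int)
    (I : nat) (e : bool) (s : nat) (f : bool) : option int :=
  if (s < 2)%N then
    if (e <= s.*2 + f <= e.+2)%N
    then Some (half_mod (m.*2 * (4 * p + 3)) (zigzag m.*2 d c (I.*2 + e) (s.*2 + f - e)))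
    else None
  else if (s < p.*2.+2)%N then
    let x := (a + 4 * (I * p.*2 + (s - 2)) + e.*2 + f + 1)%:Z in
    Some (if e (+) f (+) odd s then - x else x)
  else None.

Lemma cell_none (m p a : nat) (d : nat -> int) (c : int) (I : nat) (e : bool) (s : nat)
  (f : bool) : (p.*2.+2 <= s)%N -> cell m p a d c I e s f = None.
Proof. by move=> ps; rewrite /cell ifN ?ifN -?leqNgt //; lia. Qed.

Definition banded_array (m p a : nat) (d : nat -> int) (c : int) : parray m.*2 :=
  fun i j => cell m p a d c i./2 (odd i) (block_shift m i./2 j./2) (odd j).

(** A general [F] and [op] serve both the count of filled cells and the sum of entries. *)
Lemma big_row (R : Type) (idx : R) (op : Monoid.com_law idx) (F : option int -> R)
    (m p a : nat) (d : nat -> int) (c : int) (i : 'I_m.*2)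
    (X := fun s => op (F (cell m p a d c i./2 (odd i) s false))
                      (F (cell m p a d c i./2 (odd i) s true))) :
  (p.*2.+2 <= m)%N -> F None = idx ->
  \big[op/idx]_(j < m.*2) F (banded_array p a d c i j) =
  op (op (X 0%N) (X 1%N)) (\big[op/idx]_(0 <= r < p) op (X r.*2.+2) (X r.*2.+3)).
Proof.
move=> pm F_none; have im : (i./2 < m)%N by have := ltn_ord i; lia.
rewrite -(big_mkord xpredT
  (fun j => F (cell m p a d c i./2 (odd i) (block_shift m i./2 j./2) (odd j)))).
rewrite big_double -(big_two_pairs _ pm) => [|s ps]; last first.
  by rewrite /X !cell_none // F_none Monoid.mulm1.
rewrite -[RHS](@big_permute _ _ _ _ (block_shift m i./2)) => [|x|x y];
  first last; [by apply: block_shift_inj | by apply: block_shift_lt |].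
apply: eq_bigr => J _.
by rewrite /X /= doubleK uphalf_double odd_double.
Qed.

Lemma big_col (R : Type) (idx : R) (op : Monoid.com_law idx) (F : option int -> R)
    (m p a : nat) (d : nat -> int) (c : int) (j : 'I_m.*2)
    (X := fun s => op (F (cell m p a d c (block_shift m s j./2) false s (odd j)))
                      (F (cell m p a d c (block_shift m s j./2) true s (odd j)))) :
  (p.*2.+2 <= m)%N -> F None = idx ->
  \big[op/idx]_(i < m.*2) F (banded_array p a d c i j) =
  op (op (X 0%N) (X 1%N)) (\big[op/idx]_(0 <= r < p) op (X r.*2.+2) (X r.*2.+3)).
Proof.
move=> pm F_none; have jm : (j./2 < m)%N by have := ltn_ord j; lia.
rewrite -(big_mkord xpredT
  (fun i => F (cell m p a d c i./2 (odd i) (block_shift m i./2 j./2) (odd j)))).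
rewrite big_double -(big_two_pairs _ pm) => [|s ps]; last first.
  by rewrite /X !cell_none // F_none Monoid.mulm1.
rewrite -[LHS](@big_permute _ _ _ _ (fun s => block_shift m s j./2)) => [|x|x y];
  first last.
- by move=> xm ym xy; rewrite -[x](@block_shiftK m _ j./2) // xy block_shiftK.
- by move=> xm; apply: block_shift_lt.
rewrite [LHS]big_nat [RHS]big_nat; apply: eq_bigr => s /andP[_ sm].
rewrite /X /= doubleK uphalf_double odd_double.
by rewrite block_shiftK.
Qed.

Lemma cell_block (m p a : nat) (d : nat -> int) (c : int) (I : nat) (e : bool) (s : nat)
    (f : bool) (x := (a + 4 * (I * p.*2 + s) + e.*2 + f + 1)%:Z) :
  (s < p.*2)%N ->
  cell m p a d c I e s.+2 f = Some (if e (+) f (+) odd s then - x else x).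
Proof. by move=> sp; rewrite /cell /= !ltnS sp negbK subn2. Qed.

(** * Sizes and sums of the lines *)

Lemma row_size (m p a : nat) (d : nat -> int) (c : int) (i : 'I_m.*2) :
  (p.*2.+2 <= m)%N ->
  (\sum_(j < m.*2) (banded_array p a d c i j != None) = 4 * p + 3)%N.
Proof.
move=> pm; rewrite (@big_row _ _ _ (fun o => nat_of_bool (o != None))) //.
rewrite (eq_big_nat _ _ (F2 := fun=> 4)) => [|r /andP[_ rp]].
  by rewrite sum_nat_const_nat /cell; case: (odd i) => /=; lia.
by rewrite !cell_block //=; lia.
Qed.

Lemma col_size (m p a : nat) (d : nat -> int) (c : int) (j : 'I_m.*2) :
  (p.*2.+2 <= m)%N ->
  (\sum_(i < m.*2) (banded_array p a d c i j != None) = 4 * p + 3)%N.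
Proof.
move=> pm; rewrite (@big_col _ _ _ (fun o => nat_of_bool (o != None))) //.
rewrite (eq_big_nat _ _ (F2 := fun=> 4)) => [|r /andP[_ rp]].
  by rewrite sum_nat_const_nat /cell; case: (odd j) => /=; lia.
by rewrite !cell_block //=; lia.
Qed.

Lemma zigzag_row (n : nat) (d : nat -> int) (c : int) (i : nat) :
  zigzag n d c i 0 + zigzag n d c i 1 + zigzag n d c i 2 = 0.
Proof. by rewrite /zigzag; lia. Qed.

(** A row of a 2x2 block has sum 1 or -1, with opposite signs on the two diagonals of a pair; only
    the three band entries remain. *)
Lemma row_sum (m p a : nat) (d : nat -> int) (c : int) (i : 'I_m.*2) :
  (p.*2.+2 <= m)%N ->
  ((\sum_(j < m.*2) cell_val (banded_array p a d c i j))
     %% (2 * m.*2 * (4 * p + 3) + 1)%:Z)%Z = 0.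
Proof.
move=> pm; rewrite big_row // (eq_big_nat _ _ (F2 := fun=> 0)) => [|r /andP[_ rp]]; last first.
  rewrite !cell_block ?ltn_double ?ltn_Sdouble //= odd_double /= !addbF !addbT.
  by case: (odd i) => /=; lia.
rewrite -mulnA big1 // /cell; case: (odd i) => /=; rewrite ?add0r ?addr0 ?addrA ?addn0;
  exact/half_mod_sum3/zigzag_row.
Qed.

Lemma succ_mod_double (m I : nat) : (I < m)%N -> succ_mod m.*2 I.*2 = I.*2.+1.
Proof. by move=> Im; rewrite /succ_mod ifT; lia. Qed.

(** Row [2 J] follows the last row of block row [J - 1]; for [J = 0] the band wraps around here. *)
Lemma succ_mod_shift (m J : nat) : (J < m)%N ->
  succ_mod m.*2 (block_shift m 1 J).*2.+1 = J.*2.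
Proof.
by move=> Jm; rewrite /block_shift; case: ifP => ?; rewrite /succ_mod; case: ifP => ?; lia.
Qed.

Lemma block_shift0 (m J : nat) : block_shift m 0 J = J.
Proof. exact: subn0. Qed.

(** A column of a block has sum 2 or -2, again cancelling in pairs. The band puts [d_j],
    [- (d_(j-1) + d_j + c)] and [d_(j-1) + c] in column [j], from rows [j], [j - 1] and [j - 2]. *)
Lemma col_sum (m p a : nat) (d : nat -> int) (c : int) (j : 'I_m.*2) :
  (p.*2.+2 <= m)%N ->
  ((\sum_(i < m.*2) cell_val (banded_array p a d c i j))
     %% (2 * m.*2 * (4 * p + 3) + 1)%:Z)%Z = 0.
Proof.
move=> pm; rewrite big_col // (eq_big_nat _ _ (F2 := fun=> 0)) => [|r /andP[_ rp]]; last first.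
  rewrite !cell_block ?ltn_double ?ltn_Sdouble //= odd_double /= !addbF.
  by case: (odd j) => /=; lia.
have Jm : (j./2 < m)%N by have := ltn_ord j; lia.
rewrite -mulnA big1 // /cell; case: (odd j) => /=; rewrite ?add0r ?addr0 ?addrA ?addn0
  block_shift0; apply: half_mod_sum3;
  rewrite /zigzag ?addn1 succ_mod_shift // ?succ_mod_double ?block_shift_lt //; lia.
Qed.

(** * Every absolute value occurs *)

Lemma banded_array_onto_cell (m p a : nat) (d : nat -> int) (c : int) (I : nat) (e : bool)
    (s : nat) (f : bool) : (I < m)%N -> (s < m)%N ->
  exists i j : 'I_m.*2, banded_array p a d c i j = cell m p a d c I e s f.
Proof.
move=> Im sm; pose J := (if I + s < m then I + s else I + s - m)%N.
have Jm : (J < m)%N by rewrite /J; case: ifP; lia.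
have IJ : block_shift m I J = s by rewrite /block_shift /J; do 2 case: ifP; lia.
have i_lt : (e + I.*2 < m.*2)%N by lia.
have j_lt : (f + J.*2 < m.*2)%N by lia.
exists (Ordinal i_lt), (Ordinal j_lt).
by rewrite /banded_array /= !half_bit_double IJ !oddD !odd_double !oddb !addbF.
Qed.

Lemma banded_array_onto (m p a b : nat) (d : nat -> int) (c : int) :
  (p.*2.+2 <= m)%N -> (a + b = 3 * m.*2)%N -> zigzag_onto m.*2 a b d c ->
  forall x, (1 <= x <= m.*2 * (4 * p + 3))%N ->
  exists i j y, banded_array (m := m) p a d c i j = Some y /\ `|y|%N = x.
Proof.
move=> pm ab d_onto x /andP[x_gt0 x_le].
set N := (m.*2 * (4 * p + 3))%N in x_le.
have N_def : N = (a + b + 4 * (m * p.*2))%N by rewrite ab /N; lia.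
suff [I [e [s [f [y [Im sm Iesf yx]]]]]] : exists I e s f y,
    [/\ (I < m)%N, (s < m)%N, cell m p a d c I e s f = Some y & `|y|%N = x].
  have [i [j ij]] := banded_array_onto_cell p a d c e f Im sm.
  by exists i, j, y; rewrite ij.
have encoded z : (if odd z then z < b.*2 else 0 < z <= a.*2)%N ->
    (forall w : int, `|w|%N = z -> `|half_mod N w|%N = x) ->
    exists I e s f y,
      [/\ (I < m)%N, (s < m)%N, cell m p a d c I e s f = Some y & `|y|%N = x].
  move=> /d_onto[i [t [im t3 itz]]] zx.
  (* Column [i + t] is at distance [t + odd i] from the first column of block column [i./2]. *)
  exists i./2, (odd i), (t + odd i)./2, (odd (t + odd i)).
  exists (half_mod N (zigzag m.*2 d c i t)).
  split; [lia | lia | | exact: zx].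
  rewrite /cell ifT; last lia.
  rewrite [((_./2).*2 + odd (t + _))%N]addnC odd_double_half ifT; last lia.
  by rewrite addnK [(_.*2 + odd i)%N]addnC odd_double_half.
case: (leqP x a) => xa.
  apply: (encoded x.*2); first by rewrite odd_double; lia.
  by move=> w; exact: half_mod_even.
case: (leqP x (N - b)) => xb; last first.
  apply: (encoded ((N - x).*2 + 1)%N); first by rewrite oddD odd_double /=; lia.
  by move=> w; exact: half_mod_odd.
(* The middle interval: [q = 4 u + 2 e + f] with [u = I * 2 p + (s - 2)], so successive divisions
   recover the cell. *)
pose q := (x - a - 1)%N; pose u := (q %/ 4)%N.
have u_lt : (u < m * p.*2)%N by rewrite /u /q; lia.
have p_gt0 : (0 < p.*2)%N by case: p.*2 u_lt => //; rewrite muln0.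
exists (u %/ p.*2)%N, (odd q./2), (u %% p.*2).+2, (odd q).
rewrite cell_block ?ltn_mod //; eexists; split; [| | by [] |].
- by rewrite ltn_divLR.
- by apply: leq_trans pm; rewrite !ltnS ltn_mod.
- by rewrite -divn_eq; case: ifP => _; rewrite /u /q; lia.
Qed.

Local Close Scope ring_scope.

Theorem theorem5p2 (n k : nat) :
  n = 2 %[mod 4] -> k = 3 %[mod 4] -> (3 <= k)%N -> (k < n)%N ->
  exists A : parray n, is_heffter n k A.
Proof.
move=> n2 k3 _ kn.
have [m n_def] : exists m, n = m.*2 by exists n./2; lia.
have [p k_def] : exists p, k = (4 * p + 3)%N by exists (k %/ 4)%N; lia.
(* [4 p + 3 < 2 m] leaves room for [2 p + 2] distinct block diagonals. *)
subst n k; have pm : (p.*2.+2 <= m)%N by lia.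
suff [a [b [d [c [ab d_onto]]]]] : exists a b d c,
    (a + b = 3 * m.*2)%N /\ zigzag_onto m.*2 a b d c.
  exists (banded_array p a d c).
  apply: is_heffter_of_onto => [i|j|i|j|x x_bd].
  - exact: row_size.
  - exact: col_size.
  - exact: row_sum.
  - exact: col_sum.
  - exact: (banded_array_onto pm ab d_onto x_bd).
(* As [m] is odd and at least 2, either [n = 6] or [n = 4 h + 6] with [h > 0]. *)
have [m3 | m_gt3] := eqVneq m 3.
  by exists 14%N, 4%N, d_6, (- 2%:Z)%R; rewrite m3; split=> //; exact: zigzag_onto_6.
have [h m_def] : exists h, m.*2 = (4 * h + 6)%N by exists ((m - 3) %/ 2)%N; lia.
exists (8 * h + 10)%N, (4 * h + 8)%N, (d_large h), (- (8 * h + 9)%:Z)%R.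
by rewrite m_def; split; [lia | apply: zigzag_onto_large; lia].
Qed.
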